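(* Let $n \geq 3$. Let $G \colon \mathbf{Ring}^{\mathrm{op}} \to \mathbf{Scheme}$ be any functor that assigns to each commutative ring its Zariski spectrum, i.e. the restriction of $G$ to $\mathbf{cRing}^{\mathrm{op}}$ is the usual functor $\mathrm{Spec} \colon \mathbf{cRing}^{\mathrm{op}} \to \mathbf{Scheme}$ (up to natural isomorphism). Then $G$ trivializes on the ring $\mathbb{M}_n(\mathbb{C})$ of $n$-by-$n$ complex matrices: $G(\mathbb{M}_n(\mathbb{C}))$ is the initial object of $\mathbf{Scheme}$, the empty scheme.
   Context: All rings are unital. $\mathbf{Ring}$ is the category of (not necessarily commutative) rings and unital ring homomorphisms, and $\mathbf{cRing}$ is its full subcategory of commutative rings. $\mathbf{Scheme}$ is the category of schemes with the usual morphisms (morphisms of locally ringed spaces). The functor $\mathrm{Spec}$ sends a commutative ring to its Zariski spectrum, the affine scheme given by its set of prime ideals with the Zariski topology and usual structure sheaf. *)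

(* Defs.v *)
From HB Require Import structures.
From mathcomp Require Import all_boot all_order all_algebra.
From mathcomp Require Import generic_quotient.
From mathcomp Require Import all_classical all_reals topology.
From mathcomp Require Import complex ring.

Set Implicit Arguments.
Unset Strict Implicit.
Unset Printing Implicit Defensive.

Import GRing.Theory.

Local Open Scope classical_set_scope.
Local Open Scope quotient_scope.
Local Open Scope ring_scope.

Record category := Category {
  ob :> Type;
  hom : ob -> ob -> Type;
  idm : forall a, hom a a;
  compm : forall a b c, hom b c -> hom a b -> hom a c;
  comp1m : forall a b (f : hom a b), compm (idm b) f = f;
  compm1 : forall a b (f : hom a b), compm f (idm a) = f;
  compmA : forall a b c d (h : hom c d) (g : hom b c) (f : hom a b),
    compm h (compm g f) = compm (compm h g) f }.

Definition opcat (C : category) : category :=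
  @Category C (fun a b => hom b a) (@idm C) (fun a b c g f => compm f g)
    (fun a b f => compm1 f) (fun a b f => comp1m f)
    (fun a b c d h g f => esym (compmA f g h)).

Record functor (C D : category) := Functor {
  fob :> C -> D;
  fmap : forall a b, hom a b -> hom (fob a) (fob b);
  fmap1 : forall a, fmap (idm a) = idm (fob a);
  fmapM : forall a b c (g : hom b c) (f : hom a b),
    fmap (compm g f) = compm (fmap g) (fmap f) }.
Arguments fmap {C D} f0 {a b}.

Definition compF (C D E : category) (G : functor D E) (F : functor C D) :
    functor C E :=
  @Functor C E (fun a => G (F a)) (fun a b f => fmap G (fmap F f))
    (fun a => etrans (congr1 (fmap G) (fmap1 F a)) (fmap1 G (F a)))
    (fun a b c g f => etrans (congr1 (fmap G) (fmapM F g f))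
                             (fmapM G (fmap F g) (fmap F f))).

Definition opF (C D : category) (F : functor C D) :
    functor (opcat C) (opcat D) :=
  @Functor (opcat C) (opcat D) F (fun a b f => fmap F f) (fmap1 F)
    (fun a b c g f => fmapM F f g).

Definition is_iso (C : category) (a b : C) (f : hom a b) :=
  exists g : hom b a, compm g f = idm a /\ compm f g = idm b.

Definition nat_isomorphic (C D : category) (F G : functor C D) :=
  exists eta : forall a, hom (F a) (G a),
    (forall a, is_iso (eta a)) /\
    (forall a b (f : hom a b),
       compm (eta b) (fmap F f) = compm (fmap G f) (eta a)).

Definition initial (C : category) (a : C) :=
  forall b : C, exists f : hom a b, forall g : hom a b, g = f.

Lemma rmorph_eq (A B : pzRingType) (f g : {rmorphism A -> B}) :
  f =1 g -> f = g.
Proof.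
case: f => f [[[f0 fD]] [[f1 fM]]]; case: g => g [[[g0 gD]] [[g1 gM]]] /= fg.
have {}fg : f = g by apply/funext.
subst g; congr (GRing.RMorphism.Pack (GRing.RMorphism.Class _ _)).
  by congr GRing.isNmodMorphism.Axioms_; congr pair; exact: Prop_irrelevance.
by congr GRing.isMonoidMorphism.Axioms_; congr pair; exact: Prop_irrelevance.
Qed.

(* pzRingType: the zero ring is an object *)
Program Definition Ring : category :=
  @Category pzRingType (fun A B => {rmorphism A -> B}) (fun A => idfun)
    (fun A B C g f => g \o f) _ _ _.
Next Obligation. by move=> A B f; exact: rmorph_eq. Qed.
Next Obligation. by move=> A B f; exact: rmorph_eq. Qed.
Next Obligation. by move=> A B C D h g f; exact: rmorph_eq. Qed.

Program Definition cRing : category :=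
  @Category comPzRingType (fun A B => {rmorphism A -> B}) (fun A => idfun)
    (fun A B C g f => g \o f) _ _ _.
Next Obligation. by move=> A B f; exact: rmorph_eq. Qed.
Next Obligation. by move=> A B f; exact: rmorph_eq. Qed.
Next Obligation. by move=> A B C D h g f; exact: rmorph_eq. Qed.

Definition cRing_incl : functor cRing Ring :=
  @Functor cRing Ring (fun A : comPzRingType => A : pzRingType)
    (fun A B f => f) (fun A => erefl) (fun A B C g f => erefl).

Definition is_unit (A : comPzRingType) (a : A) := exists b, a * b = 1.

Definition is_ideal (A : comPzRingType) (I : set A) :=
  [/\ I 0, (forall a b, I a -> I b -> I (a + b)) &
      (forall a b, I b -> I (a * b))].

Definition is_prime (A : comPzRingType) (p : set A) :=
  [/\ is_ideal p, ~ p 1 & forall a b, p (a * b) -> p a \/ p b].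

Definition is_maximal (A : comPzRingType) (m : set A) :=
  [/\ is_ideal m, ~ m 1 &
      forall I : set A, is_ideal I -> ~ I 1 -> m `<=` I -> I = m].

Definition local_ring (A : comPzRingType) := exists! m : set A, is_maximal m.

(* for local rings: f^-1(m_B) = m_A *)
Definition local_hom (A B : comPzRingType) (f : A -> B) :=
  forall m : set B, is_maximal m -> is_maximal (f @^-1` m).

Lemma nonunits_maximal (A : comPzRingType) : ~ is_unit (0 : A) ->
    (forall a b : A, is_unit (a + b) -> is_unit a \/ is_unit b) ->
  forall m : set A, is_maximal m <-> m = [set a | ~ is_unit a].
Proof.
move=> n0 nD m.
have nu_ideal : is_ideal [set a : A | ~ is_unit a].
  split=> //= [a b na nb /nD[]//|a b nb [c abc]].
  by apply: nb; exists (a * c); rewrite mulrCA mulrA.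
have nu1 : ~ [set a : A | ~ is_unit a] 1 by apply; exists 1; rewrite mulr1.
have sub (I : set A) : is_ideal I -> ~ I 1 -> I `<=` [set a | ~ is_unit a].
  move=> [_ _ IM] I1 a Ia [b ab]; apply: I1.
  by rewrite -ab mulrC; exact: IM.
split=> [[mi m1 mM]|->]; first exact/esym/mM/sub.
by split=> // I Ii I1 sI; apply/seteqP; split=> //; exact: sub.
Qed.

Lemma nonunits_local (A : comPzRingType) : ~ is_unit (0 : A) ->
    (forall a b : A, is_unit (a + b) -> is_unit a \/ is_unit b) ->
  local_ring A.
Proof.
move=> n0 nD; have mE := nonunits_maximal n0 nD.
by exists [set a | ~ is_unit a]; split=> [|m /mE ->//]; exact/mE.
Qed.

(* a commutative ring up to an equivalence relation pr_eqv; quot_ring is the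
   genuine ring of equivalence classes, used for localizations and stalks *)
Record pre_ring := PreRing {
  pr_car : Type;
  pr_eqv : pr_car -> pr_car -> Prop;
  pr_zero : pr_car;
  pr_one : pr_car;
  pr_opp : pr_car -> pr_car;
  pr_add : pr_car -> pr_car -> pr_car;
  pr_mul : pr_car -> pr_car -> pr_car;
  pr_refl : forall x, pr_eqv x x;
  pr_sym : forall x y, pr_eqv x y -> pr_eqv y x;
  pr_trans : forall x y z, pr_eqv x y -> pr_eqv y z -> pr_eqv x z;
  pr_oppP : forall x x', pr_eqv x x' -> pr_eqv (pr_opp x) (pr_opp x');
  pr_addP : forall x x' y y', pr_eqv x x' -> pr_eqv y y' ->
    pr_eqv (pr_add x y) (pr_add x' y');
  pr_mulP : forall x x' y y', pr_eqv x x' -> pr_eqv y y' ->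
    pr_eqv (pr_mul x y) (pr_mul x' y');
  pr_addA : forall x y z,
    pr_eqv (pr_add x (pr_add y z)) (pr_add (pr_add x y) z);
  pr_addC : forall x y, pr_eqv (pr_add x y) (pr_add y x);
  pr_add0 : forall x, pr_eqv (pr_add pr_zero x) x;
  pr_addN : forall x, pr_eqv (pr_add (pr_opp x) x) pr_zero;
  pr_mulA : forall x y z,
    pr_eqv (pr_mul x (pr_mul y z)) (pr_mul (pr_mul x y) z);
  pr_mulC : forall x y, pr_eqv (pr_mul x y) (pr_mul y x);
  pr_mul1 : forall x, pr_eqv (pr_mul pr_one x) x;
  pr_mulDl : forall x y z,
    pr_eqv (pr_mul (pr_add x y) z) (pr_add (pr_mul x z) (pr_mul y z)) }.

Section QuotRing.
Variable P : pre_ring.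

Let eqvb (x y : {classic pr_car P}) : bool := `[< pr_eqv x y >].

Lemma pr_equiv_class : equiv_class_of eqvb.
Proof.
apply: EquivClass => [x|x y|y x z]; rewrite /eqvb.
- exact/asboolP/pr_refl.
- by apply: asbool_equiv_eq; split=> /pr_sym.
- by move=> /asboolP xy /asboolP yz; apply/asboolP; exact: pr_trans xy yz.
Qed.

Definition pr_equiv_rel := EquivRelPack pr_equiv_class.

Definition quot_ring := {eq_quot pr_equiv_rel}.
HB.instance Definition _ := Choice.on quot_ring.

Definition qcls (x : pr_car P) : quot_ring :=
  \pi_{eq_quot pr_equiv_rel} (x : {classic pr_car P}).
Definition qrep (a : quot_ring) : pr_car P := repr a.

Lemma qcls_eq x y : qcls x = qcls y <-> pr_eqv x y.
Proof.
split=> [/eqmodP /=|h]; first by rewrite /eqvb => /asboolP.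
by apply/eqmodP; apply/asboolP.
Qed.

Lemma qrepK a : qcls (qrep a) = a.
Proof. exact: reprK. Qed.

Lemma qrepP x : pr_eqv (qrep (qcls x)) x.
Proof. by apply/qcls_eq; rewrite qrepK. Qed.

Definition qopp a := qcls (pr_opp (qrep a)).
Definition qadd a b := qcls (pr_add (qrep a) (qrep b)).
Definition qmul a b := qcls (pr_mul (qrep a) (qrep b)).

Lemma qoppE x : qopp (qcls x) = qcls (pr_opp x).
Proof. exact/qcls_eq/pr_oppP/qrepP. Qed.
Lemma qaddE x y : qadd (qcls x) (qcls y) = qcls (pr_add x y).
Proof. by apply/qcls_eq/pr_addP; exact: qrepP. Qed.
Lemma qmulE x y : qmul (qcls x) (qcls y) = qcls (pr_mul x y).
Proof. by apply/qcls_eq/pr_mulP; exact: qrepP. Qed.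

Lemma qaddA : associative qadd.
Proof.
move=> a b c; rewrite -(qrepK a) -(qrepK b) -(qrepK c) !qaddE.
exact/qcls_eq/pr_addA.
Qed.
Lemma qaddC : commutative qadd.
Proof. by move=> a b; exact/qcls_eq/pr_addC. Qed.
Lemma qadd0 : left_id (qcls (pr_zero P)) qadd.
Proof. by move=> a; rewrite -(qrepK a) qaddE; exact/qcls_eq/pr_add0. Qed.
Lemma qaddN : left_inverse (qcls (pr_zero P)) qopp qadd.
Proof. by move=> a; rewrite -(qrepK a) qoppE qaddE; exact/qcls_eq/pr_addN. Qed.
Lemma qmulA : associative qmul.
Proof.
move=> a b c; rewrite -(qrepK a) -(qrepK b) -(qrepK c) !qmulE.
exact/qcls_eq/pr_mulA.
Qed.
Lemma qmulC : commutative qmul.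
Proof. by move=> a b; exact/qcls_eq/pr_mulC. Qed.
Lemma qmul1 : left_id (qcls (pr_one P)) qmul.
Proof. by move=> a; rewrite -(qrepK a) qmulE; exact/qcls_eq/pr_mul1. Qed.
Lemma qmulDl : left_distributive qmul qadd.
Proof.
move=> a b c; rewrite -(qrepK a) -(qrepK b) -(qrepK c) qaddE !qmulE qaddE.
exact/qcls_eq/pr_mulDl.
Qed.

HB.instance Definition _ := GRing.isZmodule.Build quot_ring
  qaddA qaddC qadd0 qaddN.
HB.instance Definition _ := GRing.Zmodule_isComPzRing.Build quot_ring
  qmulA qmulC qmul1 qmulDl.

End QuotRing.

Record spec (A : comPzRingType) := Spec_point {
  pideal :> set A;
  pidealP : is_prime pideal }.

Section Localization.
Variables (A : comPzRingType) (P : spec A).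
Local Notation p := (pideal P).

Lemma prime0 : p 0. Proof. by case: (pidealP P) => -[]. Qed.
Lemma prime1 : ~ p 1. Proof. by case: (pidealP P). Qed.
Lemma primeD a b : p a -> p b -> p (a + b).
Proof. by case: (pidealP P) => -[_ + _ _ _]; exact. Qed.
Lemma primeMl a b : p b -> p (a * b).
Proof. by case: (pidealP P) => -[_ _ + _ _]; exact. Qed.
Lemma primeMr a b : p a -> p (a * b).
Proof. by rewrite mulrC; exact: primeMl. Qed.
Lemma primeNM a b : ~ p a -> ~ p b -> ~ p (a * b).
Proof. by case: (pidealP P) => _ _ pM na nb /pM[]. Qed.

Record pre_frac := PreFrac { num : A; den : A; denP : ~ p den }.
Arguments denP : clear implicits.

Definition frac_eqv (x y : pre_frac) :=
  exists2 u, ~ p u & u * (num x * den y) = u * (num y * den x).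

Program Definition loc_pre_ring : pre_ring :=
  @PreRing pre_frac frac_eqv
    (PreFrac 0 prime1) (PreFrac 1 prime1)
    (fun x => PreFrac (- num x) (denP x))
    (fun x y => PreFrac (num x * den y + num y * den x)
                  (primeNM (denP x) (denP y)))
    (fun x y => PreFrac (num x * num y) (primeNM (denP x) (denP y)))
    _ _ _ _ _ _ _ _ _ _ _ _ _ _.
Next Obligation. by move=> x; exists 1; first exact: prime1. Qed.
Next Obligation. by move=> x y [u pu e]; exists u. Qed.
Next Obligation.
move=> [a s ps] [b t pt] [c w pw] [u /= pu e] [v /= pv e'].
exists (u * v * t); first by do !apply: primeNM.
rewrite /=.
have -> : u * v * t * (a * w) = v * w * (u * (a * t)) by ring.
rewrite e; have -> : v * w * (u * (b * s)) = u * s * (v * (b * w)) by ring.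
by rewrite e'; ring.
Qed.
Next Obligation.
move=> [a s ps] [b t pt] [u /= pu e]; exists u => //=.
by rewrite !mulNr !mulrN e.
Qed.
Next Obligation.
move=> [a s ps] [a' s' ps'] [b t pt] [b' t' pt'] [u /= pu e] [v /= pv e'].
exists (u * v); first exact: primeNM.
rewrite /=.
have -> : u * v * ((a * t + b * s) * (s' * t')) =
  v * t * t' * (u * (a * s')) + u * s * s' * (v * (b * t')) by ring.
by rewrite e e'; ring.
Qed.
Next Obligation.
move=> [a s ps] [a' s' ps'] [b t pt] [b' t' pt'] [u /= pu e] [v /= pv e'].
exists (u * v); first exact: primeNM.
rewrite /=.
have -> : u * v * ((a * b) * (s' * t')) =
  (u * (a * s')) * (v * (b * t')) by ring.
by rewrite e e'; ring.
Qed.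
Next Obligation. by move=> x y z; exists 1 => /=; [exact: prime1|ring]. Qed.
Next Obligation. by move=> x y; exists 1 => /=; [exact: prime1|ring]. Qed.
Next Obligation. by move=> x; exists 1 => /=; [exact: prime1|ring]. Qed.
Next Obligation. by move=> x; exists 1 => /=; [exact: prime1|ring]. Qed.
Next Obligation. by move=> x y z; exists 1 => /=; [exact: prime1|ring]. Qed.
Next Obligation. by move=> x y; exists 1 => /=; [exact: prime1|ring]. Qed.
Next Obligation. by move=> x; exists 1 => /=; [exact: prime1|ring]. Qed.
Next Obligation. by move=> x y z; exists 1 => /=; [exact: prime1|ring]. Qed.

Definition loc : comPzRingType := quot_ring loc_pre_ring.

Definition frac (a s : A) (ps : ~ p s) : loc :=
  @qcls loc_pre_ring (PreFrac a ps).

Lemma frac_ex (x : loc) : exists a s (ps : ~ p s), x = frac a ps.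
Proof.
rewrite -(qrepK x); case: (qrep x) => a s ps.
by exists a, s, ps.
Qed.

Lemma frac_eq a s (ps : ~ p s) b t (pt : ~ p t) : frac a ps = frac b pt <->
  exists2 u, ~ p u & u * (a * t) = u * (b * s).
Proof. exact: (@qcls_eq loc_pre_ring). Qed.

Lemma frac0 : frac 0 prime1 = 0. Proof. by []. Qed.
Lemma frac1 : frac 1 prime1 = 1. Proof. by []. Qed.
Lemma fracN a s (ps : ~ p s) : - frac a ps = frac (- a) ps.
Proof. exact: (@qoppE loc_pre_ring). Qed.
Lemma fracD a s (ps : ~ p s) b t (pt : ~ p t) :
  frac a ps + frac b pt = frac (a * t + b * s) (primeNM ps pt).
Proof. exact: (@qaddE loc_pre_ring). Qed.
Lemma fracM a s (ps : ~ p s) b t (pt : ~ p t) :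
  frac a ps * frac b pt = frac (a * b) (primeNM ps pt).
Proof. exact: (@qmulE loc_pre_ring). Qed.

Lemma frac_unit a s (ps : ~ p s) : is_unit (frac a ps) <-> ~ p a.
Proof.
split=> [[x]|pa].
  have [b [t [pt ->]]] := frac_ex x.
  rewrite fracM -frac1 => /frac_eq[u pu]; rewrite mulr1 mul1r => e pa.
  apply: (primeNM pu (primeNM ps pt)); rewrite -e.
  exact/primeMl/primeMr.
exists (frac s pa); rewrite fracM -frac1; apply/frac_eq.
by exists 1; [exact: prime1|ring].
Qed.

End Localization.

Record opens (X : topologicalType) := Opens {
  oset :> set X;
  oset_open : open oset }.

Definition opensI (X : topologicalType) (U V : opens X) : opens X :=
  Opens (openI (oset_open U) (oset_open V)).

Lemma opensIl (X : topologicalType) (U V : opens X) : opensI U V `<=` U.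
Proof. by move=> x []. Qed.

Lemma opensIr (X : topologicalType) (U V : opens X) : opensI U V `<=` V.
Proof. by move=> x []. Qed.

Definition preim_opens (X Y : topologicalType) (f : X -> Y) (fc : continuous f)
    (V : opens Y) : opens X :=
  Opens ((continuousP f).1 fc (oset V) (oset_open V)).

Record presheaf (X : topologicalType) := Presheaf {
  sec :> opens X -> comPzRingType;
  res : forall U V : opens X, V `<=` U -> {rmorphism sec U -> sec V};
  res_id : forall (U : opens X) (h : U `<=` U) s, res h s = s;
  res_res : forall (U V W : opens X) (hV : V `<=` U) (hW : W `<=` V)
    (h : W `<=` U) s, res hW (res hV s) = res h s }.
Arguments res {X} p {U V}.

Lemma res_irr (X : topologicalType) (F : presheaf X) (U V : opens X)
    (h h' : V `<=` U) (s : F U) : res F h s = res F h' s.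
Proof. by rewrite (Prop_irrelevance h h'). Qed.

Lemma res_trans (X : topologicalType) (F : presheaf X) (U V W : opens X)
    (hV : V `<=` U) (hW : W `<=` V) (s : F U) :
  res F hW (res F hV s) = res F (subset_trans hW hV) s.
Proof. exact: res_res. Qed.

(* the empty cover is allowed, so sections over the empty set form the zero
   ring *)
Definition is_sheaf (X : topologicalType) (F : presheaf X) :=
  forall (U : opens X) (I : Type) (W : I -> opens X)
      (hW : forall i, W i `<=` U) (s : forall i, F (W i)),
    (U : set X) = \bigcup_i W i ->
    (forall i j (hi : opensI (W i) (W j) `<=` W i)
       (hj : opensI (W i) (W j) `<=` W j),
       res F hi (s i) = res F hj (s j)) ->
    exists! t : F U, forall i, res F (hW i) t = s i.

Section Stalk.
Variables (X : topologicalType) (F : presheaf X) (x : X).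

Record pre_germ := PreGerm { gdom : opens X; gdomP : oset gdom x; gsec : F gdom }.

Definition germ_eqv (a b : pre_germ) :=
  exists (W : opens X) (ha : W `<=` gdom a) (hb : W `<=` gdom b),
    oset W x /\ res F ha (gsec a) = res F hb (gsec b).

Definition opensTop : opens X := Opens openT.

Definition germ2 (op : forall U, F U -> F U -> F U) (a b : pre_germ) :=
  @PreGerm (opensI (gdom a) (gdom b)) (conj (gdomP a) (gdomP b))
    (op _ (res F (@opensIl _ _ _) (gsec a))
          (res F (@opensIr _ _ _) (gsec b))).

Program Definition stalk_pre_ring : pre_ring :=
  @PreRing pre_germ germ_eqv
    (@PreGerm opensTop I 0) (@PreGerm opensTop I 1)
    (fun a => @PreGerm (gdom a) (gdomP a) (- gsec a))
    (germ2 (fun U => +%R)) (germ2 (fun U => *%R))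
    _ _ _ _ _ _ _ _ _ _ _ _ _ _.
Next Obligation.
by move=> a; exists (gdom a), (fun _ => id), (fun _ => id); split=> //; exact: gdomP.
Qed.
Next Obligation. by move=> a b [W [ha [hb [Wx e]]]]; exists W, hb, ha. Qed.
Next Obligation.
move=> a b c [W [ha [hb [Wx e]]]] [W' [hb' [hc [Wx' e']]]].
have h1 : opensI W W' `<=` gdom a by move=> y [] /ha.
have h2 : opensI W W' `<=` gdom b by move=> y [] /hb.
have h3 : opensI W W' `<=` gdom c by move=> y [_] /hc.
exists (opensI W W'), h1, h3; split=> //.
rewrite -(res_res ha (@opensIl _ _ _)) e (res_res _ _ h2).
by rewrite -(res_res hb' (@opensIr _ _ _)) e' (res_res _ _ h3).
Qed.
Next Obligation.
move=> a b [W [ha [hb [Wx e]]]]; exists W, ha, hb; split=> //=.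
by rewrite !rmorphN e.
Qed.
Next Obligation.
move=> a a' b b' [W [ha [ha' [Wx e]]]] [V [hb [hb' [Vx e']]]].
have h1 : opensI W V `<=` gdom a by move=> y [] /ha.
have h2 : opensI W V `<=` gdom a' by move=> y [] /ha'.
have h3 : opensI W V `<=` gdom b by move=> y [_] /hb.
have h4 : opensI W V `<=` gdom b' by move=> y [_] /hb'.
have h : opensI W V `<=` opensI (gdom a) (gdom b).
  by move=> y [/ha ? /hb].
have h' : opensI W V `<=` opensI (gdom a') (gdom b').
  by move=> y [/ha' ? /hb'].
exists (opensI W V), h, h'; split=> //=.
rewrite !rmorphD (res_res _ _ h1) (res_res _ _ h2) (res_res _ _ h3).
rewrite (res_res _ _ h4) -(res_res ha (@opensIl _ _ _) h1) e.
by rewrite -(res_res hb (@opensIr _ _ _) h3) e' !(res_res _ _ h2, res_res _ _ h4).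
Qed.
Next Obligation.
move=> a a' b b' [W [ha [ha' [Wx e]]]] [V [hb [hb' [Vx e']]]].
have h1 : opensI W V `<=` gdom a by move=> y [] /ha.
have h2 : opensI W V `<=` gdom a' by move=> y [] /ha'.
have h3 : opensI W V `<=` gdom b by move=> y [_] /hb.
have h4 : opensI W V `<=` gdom b' by move=> y [_] /hb'.
have h : opensI W V `<=` opensI (gdom a) (gdom b).
  by move=> y [/ha ? /hb].
have h' : opensI W V `<=` opensI (gdom a') (gdom b').
  by move=> y [/ha' ? /hb'].
exists (opensI W V), h, h'; split=> //=.
rewrite !rmorphM (res_res _ _ h1) (res_res _ _ h2) (res_res _ _ h3).
rewrite (res_res _ _ h4) -(res_res ha (@opensIl _ _ _) h1) e.
by rewrite -(res_res hb (@opensIr _ _ _) h3) e' !(res_res _ _ h2, res_res _ _ h4).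
Qed.
Next Obligation.
move=> [U Ux s] [V Vx t] [W Wx w] /=; rewrite /germ2 /germ_eqv /=.
set Q := opensI U (opensI V W).
have h1 : Q `<=` U by move=> y [].
have h2 : Q `<=` V by move=> y [_ []].
have h3 : Q `<=` W by move=> y [_ []].
have h4 : Q `<=` opensI V W by move=> y [].
have h5 : Q `<=` opensI U V by move=> y [? []].
have h6 : Q `<=` opensI (opensI U V) W by move=> y [? []].
exists Q, (fun _ => id), h6; split=> //.
rewrite !rmorphD !(res_res _ _ h4, res_res _ _ h5).
by rewrite !(res_res _ _ h1) !(res_res _ _ h2) !(res_res _ _ h3) addrA.
Qed.
Next Obligation.
move=> [U Ux s] [V Vx t] /=; rewrite /germ2 /germ_eqv /=.
have h1 : opensI U V `<=` U by move=> y [].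
have h2 : opensI U V `<=` V by move=> y [].
have h3 : opensI U V `<=` opensI V U by move=> y [].
exists (opensI U V), (fun _ => id), h3; split=> //.
by rewrite !rmorphD !(res_res _ _ h1) !(res_res _ _ h2) addrC.
Qed.
Next Obligation.
move=> [U Ux s] /=; rewrite /germ2 /germ_eqv /=.
have h1 : U `<=` opensI opensTop U by move=> y.
exists U, h1, (fun _ => id); split=> //.
by rewrite rmorphD !rmorph0 add0r (res_res _ _ (fun _ => id)).
Qed.
Next Obligation.
move=> [U Ux s] /=; rewrite /germ2 /germ_eqv /=.
have h1 : U `<=` opensI U U by move=> y.
exists U, h1, (fun _ _ => I); split=> //.
by rewrite rmorphD !rmorphN !(res_res _ _ (fun _ => id)) rmorph0 addNr.
Qed.
Next Obligation.
move=> [U Ux s] [V Vx t] [W Wx w] /=; rewrite /germ2 /germ_eqv /=.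
set Q := opensI U (opensI V W).
have h1 : Q `<=` U by move=> y [].
have h2 : Q `<=` V by move=> y [_ []].
have h3 : Q `<=` W by move=> y [_ []].
have h4 : Q `<=` opensI V W by move=> y [].
have h5 : Q `<=` opensI U V by move=> y [? []].
have h6 : Q `<=` opensI (opensI U V) W by move=> y [? []].
exists Q, (fun _ => id), h6; split=> //.
rewrite !rmorphM !(res_res _ _ h4, res_res _ _ h5).
by rewrite !(res_res _ _ h1) !(res_res _ _ h2) !(res_res _ _ h3) mulrA.
Qed.
Next Obligation.
move=> [U Ux s] [V Vx t] /=; rewrite /germ2 /germ_eqv /=.
have h1 : opensI U V `<=` U by move=> y [].
have h2 : opensI U V `<=` V by move=> y [].
have h3 : opensI U V `<=` opensI V U by move=> y [].
exists (opensI U V), (fun _ => id), h3; split=> //.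
by rewrite !rmorphM !(res_res _ _ h1) !(res_res _ _ h2) mulrC.
Qed.
Next Obligation.
move=> [U Ux s] /=; rewrite /germ2 /germ_eqv /=.
have h1 : U `<=` opensI opensTop U by move=> y.
exists U, h1, (fun _ => id); split=> //.
by rewrite rmorphM !rmorph1 mul1r (res_res _ _ (fun _ => id)).
Qed.
Next Obligation.
move=> [U Ux s] [V Vx t] [W Wx w] /=; rewrite /germ2 /germ_eqv /=.
set Q := opensI (opensI U V) W.
have h1 : Q `<=` U by move=> y [] [].
have h2 : Q `<=` V by move=> y [] [].
have h3 : Q `<=` W by move=> y [].
have h4 : Q `<=` opensI U V by move=> y [].
have h5 : Q `<=` opensI U W by move=> y [] [].
have h6 : Q `<=` opensI V W by move=> y [] [].
have h7 : Q `<=` opensI (opensI U W) (opensI V W) by move=> y [] [].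
exists Q, (fun _ => id), h7; split=> //.
rewrite !rmorphM !rmorphD !(res_res _ _ h4, res_res _ _ h5, res_res _ _ h6).
rewrite ?(rmorphM, rmorphD) !(res_res _ _ h5, res_res _ _ h6).
rewrite !(res_res _ _ h1) !(res_res _ _ h2) !(res_res _ _ h3).
by rewrite mulrDl.
Qed.

Definition stalk : comPzRingType := quot_ring stalk_pre_ring.

Definition germ (U : opens X) (Ux : oset U x) (s : F U) : stalk :=
  @qcls stalk_pre_ring (PreGerm Ux s).

End Stalk.

Section StalkTheory.
Variables (X : topologicalType) (F : presheaf X) (x : X).

Lemma germ_ex (t : stalk F x) :
  exists (U : opens X) (Ux : oset U x) (s : F U), t = germ Ux s.
Proof.
rewrite -(qrepK t); case: (qrep t) => U Ux s.
by exists U, Ux, s.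
Qed.

Lemma germ_eq (U V : opens X) (Ux : oset U x) (Vx : oset V x)
    (s : F U) (t : F V) :
  germ Ux s = germ Vx t <->
  exists (W : opens X) (hU : W `<=` U) (hV : W `<=` V),
    oset W x /\ res F hU s = res F hV t.
Proof. exact: (@qcls_eq (stalk_pre_ring F x)). Qed.

Lemma germ_res (U V : opens X) (Ux : oset U x) (Vx : oset V x)
    (h : V `<=` U) (s : F U) : germ Vx (res F h s) = germ Ux s.
Proof.
apply/germ_eq; exists V, (fun _ => id), h; split=> //.
exact: res_id.
Qed.

Lemma germ0 : @germ X F x (opensTop X) I 0 = 0. Proof. by []. Qed.
Lemma germ1 : @germ X F x (opensTop X) I 1 = 1. Proof. by []. Qed.

Lemma germD (U : opens X) (Ux : oset U x) (s t : F U) :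
  germ Ux s + germ Ux t = germ Ux (s + t).
Proof.
rewrite [LHS](@qaddE (stalk_pre_ring F x)); apply/germ_eq.
have h : U `<=` opensI U U by [].
exists U, h, (fun _ => id); split=> //=.
by rewrite rmorphD !(res_res _ _ (fun _ => id)) !res_id.
Qed.

Lemma germM (U : opens X) (Ux : oset U x) (s t : F U) :
  germ Ux s * germ Ux t = germ Ux (s * t).
Proof.
rewrite [LHS](@qmulE (stalk_pre_ring F x)); apply/germ_eq.
have h : U `<=` opensI U U by [].
exists U, h, (fun _ => id); split=> //=.
by rewrite rmorphM !(res_res _ _ (fun _ => id)) !res_id.
Qed.

End StalkTheory.

Record ringed_space := RingedSpace {
  rs_space :> topologicalType;
  rs_sheaf : presheaf rs_space;
  rs_sheafP : is_sheaf rs_sheaf }.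
Local Notation "''O_' X" := (rs_sheaf X) (at level 8, X at level 2).

Record rs_hom (X Y : ringed_space) := RsHom {
  rs_map :> X -> Y;
  rs_cont : continuous rs_map;
  rs_sharp : forall V : opens Y,
    {rmorphism 'O_Y V -> 'O_X (preim_opens rs_cont V)};
  rs_nat : forall (V W : opens Y) (h : W `<=` V)
      (h' : preim_opens rs_cont W `<=` preim_opens rs_cont V) (s : 'O_Y V),
    rs_sharp W (res _ h s) = res _ h' (rs_sharp V s) }.
Arguments rs_cont {X Y} r.
Arguments rs_nat {X Y} r {V W} h h' s.

(* the map on stalks, computed on a chosen representative of the germ;
   see stalk_mapE *)
Definition stalk_map (X Y : ringed_space) (f : rs_hom X Y) (x : X)
    (t : stalk 'O_Y (f x)) : stalk 'O_X x :=
  let g := qrep t in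
  @germ X 'O_X x (preim_opens (rs_cont f) (gdom g)) (gdomP g)
    (rs_sharp f (gdom g) (gsec g)).

Lemma stalk_mapE (X Y : ringed_space) (f : rs_hom X Y) (x : X)
    (V : opens Y) (Vx : oset V (f x)) (s : 'O_Y V) :
  stalk_map (germ Vx s) =
  @germ X 'O_X x (preim_opens (rs_cont f) V) Vx (rs_sharp f V s).
Proof.
rewrite /stalk_map; move: (qrepK (germ Vx s)).
case: (qrep _) => U Ux t /= /germ_eq[W [hU [hV [Wx e]]]].
apply/germ_eq; exists (preim_opens (rs_cont f) W).
exists (fun y => hU (f y)), (fun y => hV (f y)); split=> //.
by rewrite -!(rs_nat f) e.
Qed.

Record lrs := Lrs {
  lrs_rs :> ringed_space;
  lrs_local : forall x, local_ring (stalk 'O_lrs_rs x) }.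

Record lrs_hom (X Y : lrs) := LrsHom {
  lrs_map :> rs_hom X Y;
  lrs_mapP : forall x : X, local_hom (@stalk_map X Y lrs_map x) }.

Lemma rs_hom_eq (X Y : ringed_space) (f g : rs_hom X Y) :
  f =1 g ->
  (forall (V : opens Y) (s : 'O_Y V)
     (h : preim_opens (rs_cont g) V `<=` preim_opens (rs_cont f) V),
     res _ h (rs_sharp f V s) = rs_sharp g V s) ->
  f = g.
Proof.
case: f => f fc fs fn; case: g => g gc gs gn /= fg.
have {}fg : f = g by apply/funext.
subst g; have ? : fc = gc by exact: Prop_irrelevance.
subst gc => e; have ? : fs = gs.
  apply: functional_extensionality_dep => V; apply: rmorph_eq => s.
  by rewrite -(e V s (fun _ => id)) res_id.
by subst gs; congr RsHom; exact: Prop_irrelevance.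
Qed.

Lemma lrs_hom_eq (X Y : lrs) (f g : lrs_hom X Y) :
  f =1 g ->
  (forall (V : opens Y) (s : 'O_Y V)
     (h : preim_opens (rs_cont g) V `<=` preim_opens (rs_cont f) V),
     res _ h (rs_sharp f V s) = rs_sharp g V s) ->
  f = g.
Proof.
move=> fg e; have := rs_hom_eq fg e; case: f g {fg e} => f fl [g gl] /= fg.
by subst g; congr LrsHom; exact: Prop_irrelevance.
Qed.

Lemma continuous_id' (X : topologicalType) : continuous (@idfun X).
Proof. by move=> x; exact: cvg_id. Qed.

Lemma continuous_comp' (X Y Z : topologicalType) (g : Y -> Z) (f : X -> Y) :
  continuous g -> continuous f -> continuous (g \o f).
Proof. by move=> gc fc x; apply: continuous_comp; [exact: fc|exact: gc]. Qed.

Lemma preim_id_sub (X : topologicalType) (V : opens X) :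
  preim_opens (@continuous_id' X) V `<=` V.
Proof. by []. Qed.

Lemma preim_comp_sub (X Y Z : topologicalType) (g : Y -> Z) (f : X -> Y)
    (gc : continuous g) (fc : continuous f) (V : opens Z) :
  preim_opens (continuous_comp' gc fc) V
    `<=` preim_opens fc (preim_opens gc V).
Proof. by []. Qed.

(* preimages along composites agree only as sets, not as bundled opens, so the
   comorphisms are transported along a restriction map (an isomorphism) *)
Program Definition rs_id (X : ringed_space) : rs_hom X X :=
  @RsHom X X idfun (@continuous_id' X)
    (fun V => res 'O_X (@preim_id_sub X V)) _.
Next Obligation.
move=> X V W h h' s /=.
by rewrite !(res_res _ _ (h : preim_opens (@continuous_id' X) W `<=` V)).
Qed.

Program Definition rs_comp (X Y Z : ringed_space) (g : rs_hom Y Z)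
    (f : rs_hom X Y) : rs_hom X Z :=
  @RsHom X Z (g \o f) (continuous_comp' (rs_cont g) (rs_cont f))
    (fun V => res 'O_X (@preim_comp_sub _ _ _ _ _ (rs_cont g) (rs_cont f) V)
                \o (rs_sharp f (preim_opens (rs_cont g) V) \o rs_sharp g V)) _.
Next Obligation.
move=> X Y Z g f V W h h' s /=.
set Vg := preim_opens (rs_cont g) V; set Wg := preim_opens (rs_cont g) W.
have h1 : Wg `<=` Vg by move=> y; exact: h.
have h2 : preim_opens (rs_cont f) Wg `<=` preim_opens (rs_cont f) Vg.
  by move=> y; exact: h1.
have h3 : preim_opens (continuous_comp' (rs_cont g) (rs_cont f)) W
    `<=` preim_opens (rs_cont f) Vg by move=> y; exact: h1.
by rewrite (rs_nat g _ h1) (rs_nat f _ h2) !(res_res _ _ h3).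
Qed.

Lemma stalk_map_id (X : ringed_space) (x : X) (t : stalk 'O_X x) :
  @stalk_map X X (rs_id X) x t = t.
Proof.
have [U [Ux [s ->]]] := germ_ex t.
by rewrite (@stalk_mapE X X (rs_id X) x); exact: germ_res.
Qed.

Lemma stalk_map_comp (X Y Z : ringed_space) (g : rs_hom Y Z) (f : rs_hom X Y)
    (x : X) (t : stalk 'O_Z (g (f x))) :
  @stalk_map X Z (rs_comp g f) x t = @stalk_map X Y f x (@stalk_map Y Z g _ t).
Proof.
have [U [Ux [s ->]]] := germ_ex t.
rewrite (@stalk_mapE X Z (rs_comp g f) x) !stalk_mapE.
exact: (germ_res (Ux : oset (preim_opens _ (preim_opens _ _)) x)).
Qed.

Program Definition lrs_id (X : lrs) : lrs_hom X X := @LrsHom X X (rs_id X) _.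
Next Obligation.
move=> X x m; suff -> : (@stalk_map X X (rs_id X) x) @^-1` m = m by [].
by apply/funext => t; rewrite /preimage/= stalk_map_id.
Qed.

Program Definition lrs_comp (X Y Z : lrs) (g : lrs_hom Y Z) (f : lrs_hom X Y) :
  lrs_hom X Z := @LrsHom X Z (rs_comp g f) _.
Next Obligation.
move=> X Y Z g f x m mm.
have -> : (@stalk_map X Z (rs_comp g f) x) @^-1` m =
  @stalk_map Y Z g (f x) @^-1` (@stalk_map X Y f x @^-1` m).
  by apply/funext => t; rewrite /preimage/= stalk_map_comp.
by apply: lrs_mapP; apply: lrs_mapP.
Qed.

Lemma spec_eq (A : comPzRingType) (p q : spec A) :
  pideal p = pideal q -> p = q.
Proof.
case: p => p pP; case: q => q qP /= pq; subst q.
by congr Spec_point; exact: Prop_irrelevance.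
Qed.

Section Zariski.
Variable A : comPzRingType.

Definition zariski_open (U : set (spec A)) :=
  exists E : set A, U = [set p | ~ (E `<=` pideal p)].

Lemma zariski_openT : zariski_open setT.
Proof.
by exists setT; apply/seteqP; split=> // p _ /(_ 1 I); exact: prime1.
Qed.

Lemma zariski_openI : setI_closed zariski_open.
Proof.
move=> _ _ [E ->] [E' ->].
exists [set c | exists a b, [/\ E a, E' b & c = a * b]].
apply/seteqP; split=> p /=.
  move=> [/existsNP[a /not_implyP[Ea pa]] /existsNP[b /not_implyP[Eb pb]]] h.
  by apply: (primeNM pa pb); apply: h; exists a, b.
move=> h; split=> h'; apply: h => _ [a [b [Ea Eb ->]]].
  exact/primeMr/h'.
exact/primeMl/h'.
Qed.

Lemma zariski_open_bigU (I : Type) (f : I -> set (spec A)) :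
  (forall i, zariski_open (f i)) -> zariski_open (\bigcup_i f i).
Proof.
move=> fo; exists [set a | exists E i,
  f i = [set p | ~ (E `<=` pideal p)] /\ E a].
apply/seteqP; split=> p /=.
  move=> [i _]; have [E fE] := fo i; rewrite {1}fE => h h'.
  by apply: h => a Ea; apply: h'; exists E, i.
move=> /existsNP[a /not_implyP[[E [i [fE Ea]]] pa]].
by exists i => //; rewrite fE /= => h; apply/pa/h.
Qed.

HB.instance Definition _ := gen_eqMixin (spec A).
HB.instance Definition _ := gen_choiceMixin (spec A).
HB.instance Definition _ := isOpenTopological.Build (spec A)
  zariski_openT zariski_openI zariski_open_bigU.

Lemma spec_openE : (open : set (spec A) -> Prop) = zariski_open.
Proof. by []. Qed.

Lemma basic_open (f : A) : open [set p : spec A | ~ pideal p f].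
Proof.
rewrite spec_openE; exists [set f]; apply/seteqP; split=> p /= h.
  by move=> /(_ f erefl).
by move=> pf; apply: h => _ ->.
Qed.

End Zariski.

Section StructureSheaf.
Variable A : comPzRingType.

(* sections over U: families in the product of the localizations A_p, p in U,
   that are locally given by a single fraction a / f *)
Definition locally_frac (U : opens (spec A))
    (s : forall p : spec A, oset U p -> loc p) :=
  forall p, oset U p -> exists (V : opens (spec A)) (a f : A),
    [/\ oset V p, V `<=` U &
        forall q (Vq : oset V q) (Uq : oset U q),
          exists nf : ~ pideal q f, s q Uq = frac a nf].

Record spec_sec (U : opens (spec A)) := SpecSec {
  sval :> forall p : spec A, oset U p -> loc p;
  svalP : locally_frac sval }.
Arguments sval {U} s p Up.

Lemma spec_sec_eq (U : opens (spec A)) (s t : spec_sec U) :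
  (forall p (Up : oset U p), sval s p Up = sval t p Up) -> s = t.
Proof.
case: s => s sP; case: t => t tP /= st; have {}st : s = t.
  apply: functional_extensionality_dep => p.
  by apply: functional_extensionality_dep => Up; exact: st.
by subst t; congr SpecSec; exact: Prop_irrelevance.
Qed.

Lemma sval_irr (U : opens (spec A)) (s : spec_sec U) p (h h' : oset U p) :
  sval s p h = sval s p h'.
Proof. by congr sval; exact: Prop_irrelevance. Qed.

Section Ring.
Variable U : opens (spec A).

Program Definition sec0 : spec_sec U := @SpecSec U (fun p _ => 0) _.
Next Obligation.
by move=> p Up; exists U, 0, 1; split=> // q *; exists (@prime1 _ q).
Qed.
Program Definition sec1 : spec_sec U := @SpecSec U (fun p _ => 1) _.
Next Obligation.
by move=> p Up; exists U, 1, 1; split=> // q *; exists (@prime1 _ q).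
Qed.
Program Definition secN (s : spec_sec U) : spec_sec U :=
  @SpecSec U (fun p Up => - sval s p Up) _.
Next Obligation.
move=> s p Up; have [V [a [f [Vp VU h]]]] := svalP s Up.
exists V, (- a), f; split=> // q Vq Uq; have [nf ->] := h q Vq Uq.
by exists nf; rewrite fracN.
Qed.
Program Definition secD (s t : spec_sec U) : spec_sec U :=
  @SpecSec U (fun p Up => sval s p Up + sval t p Up) _.
Next Obligation.
move=> s t p Up; have [V [a [f [Vp VU h]]]] := svalP s Up.
have [W [b [g [Wp WU k]]]] := svalP t Up.
exists (opensI V W), (a * g + b * f), (f * g).
split=> // [q [/VU//]|q [Vq Wq] Uq].
have [nf ->] := h q Vq Uq; have [ng ->] := k q Wq Uq.
by exists (primeNM nf ng); rewrite fracD.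
Qed.
Program Definition secM (s t : spec_sec U) : spec_sec U :=
  @SpecSec U (fun p Up => sval s p Up * sval t p Up) _.
Next Obligation.
move=> s t p Up; have [V [a [f [Vp VU h]]]] := svalP s Up.
have [W [b [g [Wp WU k]]]] := svalP t Up.
exists (opensI V W), (a * b), (f * g).
split=> // [q [/VU//]|q [Vq Wq] Uq].
have [nf ->] := h q Vq Uq; have [ng ->] := k q Wq Uq.
by exists (primeNM nf ng); rewrite fracM.
Qed.

HB.instance Definition _ := gen_eqMixin (spec_sec U).
HB.instance Definition _ := gen_choiceMixin (spec_sec U).

Lemma secDA : associative secD.
Proof. by move=> s t u; apply: spec_sec_eq => p Up /=; rewrite addrA. Qed.
Lemma secDC : commutative secD.
Proof. by move=> s t; apply: spec_sec_eq => p Up /=; rewrite addrC. Qed.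
Lemma sec0D : left_id sec0 secD.
Proof. by move=> s; apply: spec_sec_eq => p Up /=; rewrite add0r. Qed.
Lemma secND : left_inverse sec0 secN secD.
Proof. by move=> s; apply: spec_sec_eq => p Up /=; rewrite addNr. Qed.
Lemma secMA : associative secM.
Proof. by move=> s t u; apply: spec_sec_eq => p Up /=; rewrite mulrA. Qed.
Lemma secMC : commutative secM.
Proof. by move=> s t; apply: spec_sec_eq => p Up /=; rewrite mulrC. Qed.
Lemma sec1M : left_id sec1 secM.
Proof. by move=> s; apply: spec_sec_eq => p Up /=; rewrite mul1r. Qed.
Lemma secMDl : left_distributive secM secD.
Proof. by move=> s t u; apply: spec_sec_eq => p Up /=; rewrite mulrDl. Qed.

HB.instance Definition _ := GRing.isZmodule.Build (spec_sec U)
  secDA secDC sec0D secND.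
HB.instance Definition _ := GRing.Zmodule_isComPzRing.Build (spec_sec U)
  secMA secMC sec1M secMDl.

End Ring.

Section Restriction.
Variables (U V : opens (spec A)) (VU : V `<=` U).

Program Definition sec_res (s : spec_sec U) : spec_sec V :=
  @SpecSec V (fun p Vp => sval s p (VU Vp)) _.
Next Obligation.
move=> s p Vp; have [W [a [f [Wp WU h]]]] := svalP s (VU Vp).
exists (opensI W V), a, f; split=> // [q []//|q [Wq _] Vq].
exact: h.
Qed.

Lemma sec_res_nmod : GRing.nmod_morphism sec_res.
Proof. by split=> [|s t]; apply: spec_sec_eq. Qed.
Lemma sec_res_monoid : GRing.monoid_morphism sec_res.
Proof. by split=> [|s t]; apply: spec_sec_eq. Qed.

HB.instance Definition _ := GRing.isNmodMorphism.Build _ _ sec_res sec_res_nmod.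
HB.instance Definition _ :=
  GRing.isMonoidMorphism.Build _ _ sec_res sec_res_monoid.

End Restriction.

Program Definition spec_presheaf : presheaf (spec A) :=
  @Presheaf (spec A) (fun U => spec_sec U : comPzRingType)
    (fun U V h => sec_res h) _ _.
Next Obligation.
by move=> U h s; apply: spec_sec_eq => p Up /=; exact: sval_irr.
Qed.
Next Obligation.
by move=> U V W hV hW h s; apply: spec_sec_eq => p Up /=; exact: sval_irr.
Qed.

Lemma spec_sheafP : is_sheaf spec_presheaf.
Proof.
move=> U I W hW s UE sc.
have cov p : oset U p -> {i | oset (W i) p}.
  by move=> Up; apply: cid; move: Up; rewrite UE => -[i _ ?]; exists i.
have sE p i j (hi : oset (W i) p) (hj : oset (W j) p) :
    sval (s i) p hi = sval (s j) p hj.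
  have := sc i j (@opensIl _ _ _) (@opensIr _ _ _).
  move=> /(congr1 (fun t : spec_sec (opensI (W i) (W j)) => sval t p (conj hi hj))) /=.
  by move=> e; exact: etrans (sval_irr _ _ _) (etrans e (sval_irr _ _ _)).
pose t p (Up : oset U p) := sval (s (projT1 (cov p Up))) p (projT2 (cov p Up)).
have tP : locally_frac t.
  move=> p Up; have [i Wp] := cov p Up.
  have [V [a [f [Vp VW h]]]] := svalP (s i) Wp.
  exists V, a, f; split=> // [q /VW|q Vq Uq]; first exact: hW.
  have [nf e] := h q Vq (VW _ Vq).
  by exists nf; rewrite -e; exact: sE.
exists (SpecSec tP); split=> [i|t' t'E].
  by apply: spec_sec_eq => p Wp /=; exact: sE.
apply: spec_sec_eq => p Up /=; rewrite /t.
case: (cov p Up) => i Wp /=; rewrite -(t'E i) /=.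
by exact: sval_irr.
Qed.

Definition spec_rs : ringed_space := RingedSpace spec_sheafP.

Section Evaluation.
Variable p : spec A.

Definition stalk_eval (t : stalk spec_presheaf p) : loc p :=
  let g := qrep t in sval (gsec g) p (gdomP g).

Lemma stalk_evalE (U : opens (spec A)) (Up : oset U p) (s : spec_sec U) :
  stalk_eval (@germ _ spec_presheaf p U Up s) = sval s p Up.
Proof.
rewrite /stalk_eval; move: (qrepK (@germ _ spec_presheaf p U Up s)).
case: (qrep _) => V Vp t /= /germ_eq[W [hV [hU [Wp /= e]]]].
move: e => /(congr1 (fun t : spec_sec W => sval t p Wp)) /=.
by rewrite (Prop_irrelevance (hV p Wp) Vp) (Prop_irrelevance (hU p Wp) Up).
Qed.

Lemma stalk_eval1 : stalk_eval 1 = 1.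
Proof. by rewrite -germ1 stalk_evalE. Qed.

Lemma stalk_eval0 : stalk_eval 0 = 0.
Proof. by rewrite -germ0 stalk_evalE. Qed.

Lemma germ2_ex (x y : stalk spec_presheaf p) :
  exists (U : opens (spec A)) (Up : oset U p) (s t : spec_sec U),
    x = @germ _ spec_presheaf p U Up s /\ y = @germ _ spec_presheaf p U Up t.
Proof.
have [U [Up [s ->]]] := germ_ex x; have [V [Vp [t ->]]] := germ_ex y.
exists (opensI U V), (conj Up Vp).
exists (res spec_presheaf (@opensIl _ U V) s).
exists (res spec_presheaf (@opensIr _ U V) t).
by split; rewrite germ_res.
Qed.

Lemma stalk_evalM x y : stalk_eval (x * y) = stalk_eval x * stalk_eval y.
Proof.
have [U [Up [s [t [-> ->]]]]] := germ2_ex x y.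
by rewrite germM !stalk_evalE.
Qed.

Lemma stalk_evalD x y : stalk_eval (x + y) = stalk_eval x + stalk_eval y.
Proof.
have [U [Up [s [t [-> ->]]]]] := germ2_ex x y.
by rewrite germD !stalk_evalE.
Qed.

Lemma stalk_eval_unit x : is_unit (stalk_eval x) <-> is_unit x.
Proof.
split=> [|[y xy]]; last first.
  by exists (stalk_eval y); rewrite -stalk_evalM xy stalk_eval1.
have [U [Up [s ->]]] := germ_ex x; rewrite stalk_evalE.
have [V [a [f [Vp VU h]]]] := svalP s Up.
have [nf ->] := h p Vp Up => /frac_unit na.
pose D : opens (spec A) := Opens (basic_open a).
pose W := opensI V D.
have gP : @locally_frac W (fun q Wq => frac f (proj2 Wq)).
  by move=> q Wq; exists W, f, a; split=> // r Wr Wr'; exists (proj2 Wr').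
have Wp : oset W p by [].
have WU : W `<=` U by move=> q [/VU].
exists (@germ _ spec_presheaf p W Wp (SpecSec gP)).
rewrite -(germ_res Up Wp WU) germM -germ1; apply/germ_eq.
exists W, (fun _ => id), (fun _ _ => I); split=> //.
apply: spec_sec_eq => q Wq /=.
have [nf' ->] := h q (proj1 Wq) (WU q Wq).
rewrite fracM -frac1; apply/frac_eq.
by exists 1; [exact: prime1|ring].
Qed.

Lemma loc_unitD (x y : loc p) : is_unit (x + y) -> is_unit x \/ is_unit y.
Proof.
have [a [s [ps ->]]] := frac_ex x; have [b [t [pt ->]]] := frac_ex y.
rewrite fracD => /frac_unit nab.
have [pa|/frac_unit pa] := EM (pideal p a); last by left; exact/pa.
have [pb|/frac_unit pb] := EM (pideal p b); last by right; exact/pb.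
by exfalso; apply: nab; apply: primeD; apply: primeMr.
Qed.

Lemma loc_nunit0 : ~ is_unit (0 : loc p).
Proof. by rewrite -frac0 => /frac_unit; apply; exact: prime0. Qed.

Lemma stalk_nunit0 : ~ is_unit (0 : stalk spec_presheaf p).
Proof. by move=> /stalk_eval_unit; rewrite stalk_eval0; exact: loc_nunit0. Qed.

Lemma stalk_unitD (x y : stalk spec_presheaf p) :
  is_unit (x + y) -> is_unit x \/ is_unit y.
Proof.
move=> /stalk_eval_unit; rewrite stalk_evalD.
by move=> /loc_unitD[]/stalk_eval_unit; [left|right].
Qed.

End Evaluation.

Lemma spec_local (p : spec_rs) : local_ring (stalk (rs_sheaf spec_rs) p).
Proof. exact: (nonunits_local (@stalk_nunit0 p) (@stalk_unitD p)). Qed.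

Definition spec_lrs : lrs := Lrs spec_local.

End StructureSheaf.
Arguments sval {A U} s p Up.

Section SpecMap.
Variables (A B : comPzRingType) (phi : {rmorphism A -> B}).

Lemma preim_prime (q : spec B) : is_prime (phi @^-1` pideal q).
Proof.
split=> /=; first split; rewrite /preimage /=.
- by rewrite rmorph0; exact: prime0.
- by move=> a b; rewrite rmorphD; exact: primeD.
- by move=> a b; rewrite rmorphM; exact: primeMl.
- by rewrite rmorph1; exact: prime1.
- by move=> a b; rewrite rmorphM; case: (pidealP q) => _ _; exact.
Qed.

Definition spec_map (q : spec B) : spec A := Spec_point (preim_prime q).

Lemma spec_map_cont : continuous spec_map.
Proof.
apply/continuousP => _ [E ->]; rewrite spec_openE.
exists (phi @` E); apply/seteqP; split=> q /= h h'; apply: h.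
  by move=> a Ea; apply: h'; exists a.
by move=> _ [a Ea <-]; exact: h'.
Qed.

Section LocMap.
Variable q : spec B.

Definition loc_map (x : loc (spec_map q)) : loc q :=
  let r := qrep x in @frac B q (phi (num r)) (phi (den r)) (@denP _ _ r).

Lemma loc_mapE (a s : A) (ns : ~ pideal (spec_map q) s)
    (ns' : ~ pideal q (phi s)) :
  loc_map (frac a ns) = frac (phi a) ns'.
Proof.
rewrite /loc_map; move: (qrepK (frac a ns)); case: (qrep _) => b t nt /=.
move=> /frac_eq[u nu e]; apply/frac_eq; exists (phi u) => //.
by rewrite -!rmorphM e.
Qed.

Lemma loc_map0 : loc_map 0 = 0.
Proof.
rewrite -!frac0 loc_mapE ?rmorph1 => [|n1]; first exact: prime1.
by apply/frac_eq; exists 1; [exact: prime1|rewrite rmorph0; ring].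
Qed.

Lemma loc_map1 : loc_map 1 = 1.
Proof.
rewrite -!frac1 loc_mapE ?rmorph1 => [|n1]; first exact: prime1.
by apply/frac_eq; exists 1; [exact: prime1|ring].
Qed.

Lemma loc_mapD x y : loc_map (x + y) = loc_map x + loc_map y.
Proof.
have [a [s [ns ->]]] := frac_ex x; have [b [t [nt ->]]] := frac_ex y.
rewrite fracD (loc_mapE _ _ ns) (loc_mapE _ _ nt).
rewrite (loc_mapE _ _ (primeNM ns nt : ~ pideal q (phi (s * t)))) fracD.
apply/frac_eq; exists 1; first exact: prime1.
by rewrite !(rmorphD, rmorphM).
Qed.

Lemma loc_mapM x y : loc_map (x * y) = loc_map x * loc_map y.
Proof.
have [a [s [ns ->]]] := frac_ex x; have [b [t [nt ->]]] := frac_ex y.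
rewrite fracM (loc_mapE _ _ ns) (loc_mapE _ _ nt).
rewrite (loc_mapE _ _ (primeNM ns nt : ~ pideal q (phi (s * t)))) fracM.
apply/frac_eq; exists 1; first exact: prime1.
by rewrite !rmorphM.
Qed.

Lemma loc_map_unit x : is_unit (loc_map x) <-> is_unit x.
Proof.
have [a [s [ns ->]]] := frac_ex x; rewrite (loc_mapE _ _ ns).
by rewrite !frac_unit.
Qed.

End LocMap.

Section Sharp.
Variable V : opens (spec A).

Program Definition spec_sharp (s : spec_sec V) :
    spec_sec (preim_opens spec_map_cont V) :=
  @SpecSec B (preim_opens spec_map_cont V)
    (fun q Vq => loc_map (sval s (spec_map q) Vq)) _.
Next Obligation.
move=> s q Vq; have [W [a [f [Wq WV h]]]] := svalP s Vq.
exists (preim_opens spec_map_cont W), (phi a), (phi f).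
split=> // [r|r Wr Vr]; first exact: WV.
have [nf ->] := h _ Wr Vr.
by exists nf; exact: loc_mapE.
Qed.

Lemma spec_sharp_nmod : GRing.nmod_morphism spec_sharp.
Proof.
split=> [|s t]; apply: spec_sec_eq => q Vq /=; first exact: loc_map0.
exact: loc_mapD.
Qed.
Lemma spec_sharp_monoid : GRing.monoid_morphism spec_sharp.
Proof.
split=> [|s t]; apply: spec_sec_eq => q Vq /=; first exact: loc_map1.
exact: loc_mapM.
Qed.

HB.instance Definition _ :=
  GRing.isNmodMorphism.Build _ _ spec_sharp spec_sharp_nmod.
HB.instance Definition _ :=
  GRing.isMonoidMorphism.Build _ _ spec_sharp spec_sharp_monoid.

End Sharp.

Program Definition spec_rs_hom : rs_hom (spec_rs B) (spec_rs A) :=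
  @RsHom (spec_rs B) (spec_rs A) spec_map spec_map_cont
    (fun V => @spec_sharp V) _.
Next Obligation.
move=> V W h h' s; apply: spec_sec_eq => q Wq /=.
by congr loc_map; exact: sval_irr.
Qed.

Lemma spec_hom_local (q : spec_rs B) :
  local_hom (@stalk_map (spec_rs B) (spec_rs A) spec_rs_hom q).
Proof.
move=> m /(nonunits_maximal (@stalk_nunit0 B q) (@stalk_unitD B q)) ->.
apply/(nonunits_maximal (@stalk_nunit0 A _) (@stalk_unitD A _)).
apply/seteqP; split=> t; rewrite /preimage /=; apply: contra_not.
all: have [U [Uq [s ->]]] := germ_ex t.
all: rewrite stalk_mapE -!stalk_eval_unit !stalk_evalE /=.
all: by move=> /loc_map_unit.
Qed.

Definition spec_hom : lrs_hom (spec_lrs B) (spec_lrs A) :=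
  @LrsHom (spec_lrs B) (spec_lrs A) spec_rs_hom spec_hom_local.

End SpecMap.

(* f is an isomorphism of X onto the open subspace (U, O_Y restricted to U) *)
Definition iso_onto_open (X Y : lrs) (f : lrs_hom X Y) (U : opens Y) :=
  [/\ injective f, range f = U,
      (forall W : set X, open W -> open (f @` W)) &
      (forall V : opens Y, V `<=` U -> bijective (rs_sharp f V))].

Definition is_scheme (X : lrs) :=
  forall x : X, exists (U : opens X) (A : comPzRingType)
    (f : lrs_hom (spec_lrs A) X), oset U x /\ iso_onto_open f U.

Record scheme := Scheme_of {
  scheme_lrs :> lrs;
  schemeP : is_scheme scheme_lrs }.

Definition is_empty (X : scheme) := [set: X] = set0.

Lemma spec_is_scheme (A : comPzRingType) : is_scheme (spec_lrs A).
Proof.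
move=> x; exists (opensTop _), A, (lrs_id _); split=> //; split=> //=.
- by apply/seteqP; split=> // y _; exists y.
- by move=> W; rewrite image_id.
- move=> V _; exists (@sec_res A (preim_opens (@continuous_id' (spec A)) V) V
      (fun _ => id)) => s.
  all: by apply: spec_sec_eq => q Vq /=; exact: sval_irr.
Qed.

Definition spec_scheme (A : comPzRingType) : scheme :=
  Scheme_of (@spec_is_scheme A).

Program Definition Scheme : category :=
  @Category scheme (fun X Y => lrs_hom X Y) (fun X => lrs_id X)
    (fun X Y Z g f => lrs_comp g f) _ _ _.
Next Obligation.
move=> X Y f; apply: lrs_hom_eq => // V s h /=.
have k : preim_opens (rs_cont f) (preim_opens (@continuous_id' Y) V)
  `<=` preim_opens (rs_cont f) V by [].
have k' : preim_opens (continuous_comp' (rs_cont (lrs_id Y)) (rs_cont f)) V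
  `<=` preim_opens (rs_cont f) V by [].
by rewrite (rs_nat f _ k) (res_res _ _ k') (res_res _ _ (fun _ => id)) res_id.
Qed.
Next Obligation.
move=> X Y f; apply: lrs_hom_eq => // V s h /=.
have k : preim_opens (continuous_comp' (rs_cont f) (@continuous_id' X)) V
  `<=` preim_opens (rs_cont f) V by [].
by rewrite !(res_res _ _ k, res_res _ _ (fun _ => id)) res_id.
Qed.
Next Obligation.
move=> X Y Z T h g f; apply: lrs_hom_eq => // V s k /=.
have l : preim_opens (rs_cont f) (preim_opens (rs_cont (rs_comp h g)) V)
  `<=` preim_opens (rs_cont f) (preim_opens (rs_cont g)
         (preim_opens (rs_cont h) V)) by [].
by rewrite (rs_nat f _ l) !res_trans; exact: res_irr.
Qed.

Lemma sval_frac (A : comPzRingType) (V : opens (spec A)) (s : spec_sec V)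
    (p p' : spec A) (Vp : oset V p) (Vp' : oset V p') : p = p' ->
  exists a f (nf : ~ pideal p f) (nf' : ~ pideal p' f),
    sval s p Vp = frac a nf /\ sval s p' Vp' = frac a nf'.
Proof.
move=> pp'; subst p'; rewrite (sval_irr s Vp' Vp).
have [a [f [nf e]]] := frac_ex (sval s p Vp).
by exists a, f, nf, nf.
Qed.

Program Definition Spec : functor (opcat cRing) Scheme :=
  @Functor (opcat cRing) Scheme (fun A => spec_scheme A)
    (fun A B phi => spec_hom phi) _ _.
Next Obligation.
move=> A; apply: lrs_hom_eq => /= [p|V s h]; first exact: spec_eq.
apply: spec_sec_eq => p Vp /=.
have [|a [f [nf [nf' [-> ->]]]]] :=
    sval_frac s (h p Vp) (preim_id_sub Vp); first exact: spec_eq.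
exact: loc_mapE.
Qed.
Next Obligation.
move=> A B C g f; apply: lrs_hom_eq => /= [p|V s h]; first exact: spec_eq.
apply: spec_sec_eq => p Vp /=.
have [|a [d [nd [nd' [-> ->]]]]] :=
    sval_frac s (h p Vp) (preim_comp_sub Vp); first exact: spec_eq.
rewrite (loc_mapE _ nd' (nd' : ~ pideal (spec_map f p) (g d))).
apply: etrans (loc_mapE _ _ nd) _; apply: esym; exact: loc_mapE.
Qed.

(* Main.v *)
Require Import Defs.
From HB Require Import structures.
From mathcomp Require Import all_boot all_algebra reals complex.
From mathcomp Require Import classical_sets boolp topology ring.

(** A point of [G A] is sent, along each map from a commutative ring [C] to
    [A], to a point of [Spec C], that is, to a prime ideal of [C]; by
    naturality these primes are compatible.  Pulling back along the
    evaluations [Z['X] -> A] glues them into one subset [P] of [A] whose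
    preimage in every commutative ring over [A] is prime
    ([point_prime_partial_ideal]).  The theorem therefore reduces to the
    absence of such a prime partial ideal in a ring of matrices of size at
    least 3 ([no_prime_partial_ideal]); the rest is that the empty scheme is
    initial, because a sheaf vanishes on the empty set ([empty_initial]).

    The absence of prime partial ideals is a Kochen-Specker theorem for
    idempotents that need not be self-adjoint.  Call an idempotent green when
    it is outside [P].  Orthogonal idempotents [e], [f] and [1 - e - f] span
    the image of [Z^3], so two orthogonal idempotents are never both green,
    and a sum of mutually orthogonal idempotents is green exactly when one of
    them is.  For a column [x] and a row [u] with [u x = 1], the product [x u]
    is an idempotent of rank one, and [x u], [y v] are orthogonal when
    [u y = 0] and [v x = 0].  Allowing oblique idempotents makes the
    obstruction short.  Let [x, y, z] be columns and [u, v, w] the dual rows.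
    - If [x u] is green, then [(x + y) v] is not ([oblique_exclusion]): a
      single one of the two orthogonality relations is enough to exclude.
    - Consequently a green idempotent stays green when its column is moved
      along the kernel of its row, and when its row is moved along the
      annihilator of its column, as the two other members of a suitable
      decomposition are excluded.  Two such moves lead from [x u] to a pair
      which is excluded by [x u] itself ([outer_in_prime_partial_ideal]).
    Hence every rank one idempotent that belongs to a triple of dual bases is
    in [P].  In size at least 3 this covers the diagonal matrix units, whose
    sum is 1, and [1] is not in [P]. *)

Set Implicit Arguments.
Unset Strict Implicit.
Unset Printing Implicit Defensive.

Import GRing.Theory.

Local Open Scope classical_set_scope.
Local Open Scope ring_scope.

(** * Prime partial ideals and orthogonal idempotents *)

(** The condition bears on morphisms from commutative rings rather than on
    commutative subrings, which spares the construction of subrings; the two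
    versions agree, as the image of such a morphism is a commutative
    subring. *)
Definition prime_partial_ideal (A : pzRingType) (P : set A) :=
  forall (C : comPzRingType) (phi : {rmorphism C -> A}),
    is_prime (phi @^-1` P).

Section OrthogonalIdempotents.
Variables (A : pzRingType) (P : set A).
Hypothesis hP : prime_partial_ideal P.
Variables e f : A.
Hypotheses (ee : e * e = e) (ff : f * f = f) (ef : e * f = 0) (fe : f * e = 0).

Let g := 1 - e - f.

Definition split3 (x : int * int * int) : A :=
  e *~ x.1.1 + f *~ x.1.2 + g *~ x.2.

Let split3_nmod : GRing.nmod_morphism split3.
Proof.
rewrite /split3; split=> [|x y] /=; first by rewrite !mulr0z !addr0.
by rewrite !mulrzDr [RHS]addrACA [X in _ = X + _]addrACA.
Qed.

Let split3_monoid : GRing.monoid_morphism split3.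
Proof.
have eg : e * g = 0 by rewrite /g !mulrBr mulr1 ee ef subrr subr0.
have fg : f * g = 0 by rewrite /g !mulrBr mulr1 fe ff subr0 subrr.
have ge : g * e = 0 by rewrite /g !mulrBl mul1r ee fe subrr subr0.
have gf : g * f = 0 by rewrite /g !mulrBl mul1r ef ff subr0 subrr.
have gg : g * g = g by rewrite {1}/g !mulrBl mul1r eg fg !subr0.
rewrite /split3; split=> [|x y] /=.
  by rewrite !mulr1z /g -addrA [f + _]addrC addrNK addrC addrNK.
rewrite !mulrDl !mulrDr !mulrzAl !mulrzAr ee ef eg fe ff fg ge gf gg.
rewrite !mul0rz !addr0 !add0r -!mulrzA.
by rewrite [y.1.1 * _]mulrC [y.1.2 * _]mulrC [y.2 * _]mulrC.
Qed.

HB.instance Definition _ :=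
  GRing.isNmodMorphism.Build _ _ split3 split3_nmod.
HB.instance Definition _ :=
  GRing.isMonoidMorphism.Build _ _ split3 split3_monoid.

(** These are properties of the prime ideals of [Z^3], carried to [A] by the
    morphism that sends the coordinate idempotents to [e], [f], [1 - e - f]. *)
Lemma orthogonal_idempotents_prime :
  [/\ P e \/ P f, P e -> P f -> P (e + f) & P (e + f) -> P e].
Proof.
have [[P0 PD PM] _ PP] := hP split3.
have e1 : split3 (1, 0, 0) = e by rewrite /split3 /= mulr1z !mulr0z !addr0.
have f1 : split3 (0, 1, 0) = f.
  by rewrite /split3 /= mulr1z !mulr0z addr0 add0r.
have ef1 : split3 (1, 1, 0) = e + f by rewrite /split3 /= !mulr1z mulr0z addr0.
split.
- have := PP (1, 0, 0) (0, 1, 0); rewrite /preimage /= e1 f1; apply.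
  by have -> : ((1, 0, 0) * (0, 1, 0) : int * int * int) = 0.
- move=> Pe Pf.
  have := PD (1, 0, 0) (0, 1, 0); rewrite /preimage /= e1 f1.
  have -> : ((1, 0, 0) + (0, 1, 0) : int * int * int) = (1, 1, 0) by [].
  by rewrite ef1; apply.
- move=> Pef.
  have := PM (1, 0, 0) (1, 1, 0); rewrite /preimage /= ef1 => /(_ Pef).
  have -> : ((1, 0, 0) * (1, 1, 0) : int * int * int) = (1, 0, 0) by [].
  by rewrite e1.
Qed.

End OrthogonalIdempotents.

Lemma sum_orthogonal_idempotents (A : pzRingType) (P : set A) (I : eqType)
    (s : seq I) (e : I -> A) : prime_partial_ideal P -> uniq s ->
    (forall i j, e i * e j = if i == j then e i else 0) ->
  (forall i, P (e i)) -> P (\sum_(i <- s) e i).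
Proof.
move=> hP + eM Pe; elim: s => [|i s IHs] /=.
  have [[P0 _ _] _ _] := hP int (intmul 1).
  by move: P0; rewrite big_nil /preimage /= mulr0z.
have mul0 t j : j \notin t -> e j * (\sum_(k <- t) e k) = 0.
  move=> jt; rewrite mulr_sumr big1_seq // => k /= kt.
  by rewrite eM; case: eqP kt jt => // -> ->.
have mul0' t j : j \notin t -> (\sum_(k <- t) e k) * e j = 0.
  move=> jt; rewrite mulr_suml big1_seq // => k /= kt.
  by rewrite eM; case: eqP kt jt => // -> ->.
case/andP=> si us; rewrite big_cons.
have ss : (\sum_(k <- s) e k) * (\sum_(k <- s) e k) = \sum_(k <- s) e k.
  elim: s us {IHs si} => [|j s IHs] /=; first by rewrite !big_nil mul0r.
  case/andP=> sj us; rewrite !big_cons mulrDl !mulrDr mul0 // mul0' //.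
  by rewrite eM eqxx IHs // addr0 add0r.
have [|||_ + _] := @orthogonal_idempotents_prime A P hP (e i) _ _ ss.
- by rewrite eM eqxx.
- exact: mul0.
- exact: mul0'.
- by apply=> //; exact: IHs.
Qed.

(** * The Kochen-Specker argument *)

Section KochenSpecker.
Variables (K : comNzRingType) (n : nat) (P : set 'M[K]_n).
Hypothesis hP : prime_partial_ideal P.

(** The middle factor is 1 by 1: the product is governed by the scalar
    [u y]. *)
Lemma mul_outer (x y : 'cV[K]_n) (u v : 'rV[K]_n) :
  (x *m u) * (y *m v) = x *m (u *m y) *m v.
Proof. by rewrite [LHS]mulmxA -[x *m u *m y]mulmxA. Qed.

(** Two orthogonal idempotents have product 0, so one of them is in [P]. *)
Lemma outer_orthogonal (x y : 'cV[K]_n) (u v : 'rV[K]_n) :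
    u *m x = 1%:M -> v *m y = 1%:M -> u *m y = 0 -> v *m x = 0 ->
  ~ P (x *m u) -> P (y *m v).
Proof.
move=> ux vy uy vx nPx.
have [||||[]//] := @orthogonal_idempotents_prime _ P hP (x *m u) (y *m v).
all: by rewrite mul_outer ?ux ?vy ?uy ?vx ?mulmx1 // mulmx0 mul0mx.
Qed.

Definition dual_bases (x y z : 'cV[K]_n) (u v w : 'rV[K]_n) :=
  [/\ [/\ u *m x = 1%:M, u *m y = 0 & u *m z = 0],
      [/\ v *m x = 0, v *m y = 1%:M & v *m z = 0] &
      [/\ w *m x = 0, w *m y = 0 & w *m z = 1%:M]].

Lemma dual_bases_sum x y z u v w : dual_bases x y z u v w ->
  P (x *m u + (y *m v + z *m w)) <-> [/\ P (x *m u), P (y *m v) & P (z *m w)].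
Proof.
move=> [[ux uy uz] [vx vy vz] [wx wy wz]].
have pE := (mul_outer, (ux, uy, uz), (vx, vy, vz), (wx, wy, wz),
            mulmx1, mulmx0, mul0mx).
have oip := @orthogonal_idempotents_prime _ P hP.
have [||||_ Pyz' Py'] := oip (y *m v) (z *m w); rewrite ?pE //.
have [||||_ _ Pz'] := oip (z *m w) (y *m v); rewrite ?pE //.
have [||||_ Pxyz Px'] := oip (x *m u) (y *m v + z *m w);
  rewrite ?(mulrDl, mulrDr) ?pE ?addr0 ?add0r //.
have [||||_ _ Pr] := oip (y *m v + z *m w) (x *m u);
  rewrite ?(mulrDl, mulrDr) ?pE ?addr0 ?add0r //.
split=> [Ps|[Px Py Pz]]; last exact/Pxyz/Pyz'.
have Pyz : P (y *m v + z *m w) by apply: Pr; rewrite addrC.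
by split; [exact: Px'|exact: Py'|apply: Pz'; rewrite addrC].
Qed.

(* Each relation between the old bases is cleared once rewritten everywhere in
   the goal; that makes the loop end. *)
Ltac dual := rewrite ?(mulmxDl, mulmxDr, mulmxBl, mulmxBr, mulNmx, mulmxN);
  (do !match goal with H : _ *m _ = _ |- _ => rewrite ?H; clear H end);
  rewrite ?(opprK, oppr0, subr0, sub0r, addr0, add0r, subrr, addNr).

(* The identities between sums of outer products are checked entrywise, where
   the coefficients commute. *)
Ltac outer := apply/matrixP => i j; rewrite !mxE !big_ord1 !mxE; ring.

(** Both decompositions have the same sum, which is outside [P] as soon as one
    of its members is; so one member of the second decomposition is outside
    [P] too. *)
Lemma dual_bases_notin x y z u v w x' y' z' u' v' w' :
    dual_bases x y z u v w -> dual_bases x' y' z' u' v' w' ->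
    x *m u + (y *m v + z *m w) = x' *m u' + (y' *m v' + z' *m w') ->
  ~ P (x *m u) -> P (y' *m v') -> P (z' *m w') -> ~ P (x' *m u').
Proof.
move=> d d' e nPx Py Pz Px; apply: nPx.
have : P (x' *m u' + (y' *m v' + z' *m w')) by apply/dual_bases_sum.
by rewrite -e => /(dual_bases_sum d)[].
Qed.

(** Although [u (x + y) = 1], so that [x u] and [(x + y) v] do not commute,
    [v x = 0] is enough to prevent both from being outside [P].  If both were,
    every rank one idempotent orthogonal to either would be in [P]; two new
    decompositions, each with two such members, would put their third members
    [(x - z) (v - w)] and [x (u + w)] outside [P], and these are orthogonal to
    each other. *)
Lemma oblique_exclusion x y z u v w : dual_bases x y z u v w ->
  ~ P (x *m u) -> P ((x + y) *m v).
Proof.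
move=> d nPx; apply: contrapT => nPxy.
have [[ux uy uz] [vx vy vz] [wx wy wz]] := d.
have P1 : P (x *m (u - v + w)) by apply: outer_orthogonal nPxy; dual.
have P2 : P ((y + z) *m v) by apply: outer_orthogonal nPx; dual.
have nP3 : ~ P ((x - z) *m (v - w)).
  apply: (dual_bases_notin d) nPx P1 P2; first by split; split; dual.
  outer.
have P4 : P ((x - z) *m - w) by apply: outer_orthogonal nPxy; dual.
have P5 : P (y *m v) by apply: outer_orthogonal nPx; dual.
have nP6 : ~ P (x *m (u + w)).
  apply: (dual_bases_notin d) nPx P4 P5; first by split; split; dual.
  outer.
by apply: nP6; apply: outer_orthogonal nP3; dual.
Qed.

(** If [x u] were outside [P], so would be [(x - y) u], then [(x - y) (- v)],
    against oblique exclusion.  Each step changes basis in the plane of [x]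
    and [y] only; besides [z w], which is orthogonal to [x u], the member it has
    to place in [P] is excluded obliquely. *)
Lemma outer_in_prime_partial_ideal x y z u v w :
  dual_bases x y z u v w -> P (x *m u).
Proof.
move=> d; apply: contrapT => nP1.
have [[ux uy uz] [vx vy vz] [wx wy wz]] := d.
have Pz : P (z *m w) by apply: outer_orthogonal nP1; dual.
have d1 : dual_bases (x - y) y z u (u + v) w by split; split; dual.
have nP2 : ~ P ((x - y) *m u).
  apply: (dual_bases_notin d d1 _ nP1 _ Pz); first outer.
  have d1' : dual_bases y (x - y) z (u + v) u w by split; split; dual.
  (* [x] is the sum of [y] and [x - y], so [y (u + v)] excludes [x u]. *)
  apply: contrapT => /(oblique_exclusion d1').
  by rewrite [y + _]addrC subrK => /nP1.
have d2 : dual_bases (x - y) x z (- v) (u + v) w by split; split; dual.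
have nP3 : ~ P ((x - y) *m - v).
  apply: (dual_bases_notin d1 d2 _ nP2 _ Pz); first outer.
  by have := oblique_exclusion d1 nP2; rewrite subrK.
(* The signs make [x - y] the sum of the first two columns of [d3]. *)
have d3 : dual_bases x (- y) z u (- v) w by split; split; dual.
exact/nP3/(oblique_exclusion d3).
Qed.

Lemma no_prime_partial_ideal : (3 <= n)%N -> False.
Proof.
move=> n3.
(* Size at least 3 provides two further basis vectors next to the i-th one. *)
have Prow (i : 'I_n) : P ((delta_mx i 0 : 'cV_n) *m (delta_mx 0 i : 'rV_n)).
  have /card_gt1P[j [k []]] : (1 < #|[set~ i]%SET|)%N.
    by rewrite cardsC1 card_ord; case: n n3 => [|[|[]]].
  rewrite !inE => ji ki jk.
  have e1 (l : 'I_n) : delta_mx 0 l *m delta_mx l 0 = 1%:M :> 'M[K]_1.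
    by rewrite mul_delta_mx; apply/matrixP => a b; rewrite !ord1 !mxE.
  apply: (@outer_in_prime_partial_ideal _ (delta_mx j 0) (delta_mx k 0)
    _ (delta_mx 0 j) (delta_mx 0 k)).
  by split; split; rewrite ?e1 // mul_delta_mx_0 // eq_sym.
have Pdiag i : P (delta_mx i i).
  by have := Prow i; rewrite mul_delta_mx.
have [_ P1 _] := hP (intmul 1 : {rmorphism int -> 'M[K]_n}).
apply: P1; rewrite /preimage /= mulr1z [1]mx1_sum_delta.
apply: sum_orthogonal_idempotents => //; first exact: index_enum_uniq.
move=> i j; rewrite -[_ * _]/(_ *m _) mul_delta_mx_cond.
by case: eqP => [->|]; rewrite ?mulr1n ?mulr0n.
Qed.

End KochenSpecker.

(** * From points to prime partial ideals *)

(** Evaluating polynomials in [C] involves polynomials over [C], hence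
    [1 != 0].  An equality of structures, rather than an isomorphism, lets
    morphisms out of [C] be reused as they are. *)
Lemma nontrivial_comNzRing (C : comPzRingType) :
  1 != 0 :> C -> exists C' : comNzRingType, C = C'.
Proof.
move=> C1; exists (HB.pack_for comNzRingType (GRing.ComPzRing.sort C)
  (GRing.PzSemiRing_isNonZero.Build C C1)).
by case: C C1 => ? [].
Qed.

(** An element [a] is put in [P] when the variable of [Z['X]] lies in the prime
    assigned to the evaluation at [a].  For [c] in a commutative ring [C] over
    [A], evaluation at the image of [c] factors through [C], and naturality
    identifies this condition with membership of [c] in the prime of [C]; so
    the preimage of [P] in [C] is that prime. *)
Lemma point_prime_partial_ideal (G : functor (opcat Ring) Scheme)
    (GSpec : nat_isomorphic (compF G (opF cRing_incl)) Spec)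
    (A : nzRingType) (x : (G A : scheme)) :
  exists P : set A, prime_partial_ideal P.
Proof.
have [eta [_ eta_nat]] := GSpec.
pose Gm (B D : pzRingType) (phi : {rmorphism D -> B}) :
  lrs_hom (G B : scheme) (G D : scheme) := @Defs.fmap _ _ G B D phi.
pose pt (C : comPzRingType) (phi : {rmorphism C -> A}) : spec C :=
  (eta C : lrs_hom (G C : scheme) (spec_scheme C)) (Gm A C phi x).
have ptM (C D : comPzRingType) (phi : {rmorphism D -> A})
    (psi : {rmorphism C -> D}) :
    pideal (pt C (phi \o psi)) = psi @^-1` pideal (pt D phi).
  have GM : Gm A C (phi \o psi) = lrs_comp (Gm D C psi) (Gm A D phi).
    exact: (@fmapM _ _ G A D C psi phi).
  rewrite /pt GM.
  exact: (congr1 (fun h : lrs_hom (G D : scheme) (spec_scheme C) =>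
    pideal (h (Gm A D phi x))) (eta_nat D C psi)).
have intrC (a : A) : commr_rmorph (intmul 1 : {rmorphism int -> A}) a.
  by move=> m; exact: commr_int.
exists [set a | pideal (pt _ (horner_morph (intrC a))) 'X] => C phi.
suff -> : phi @^-1` [set a | pideal (pt _ (horner_morph (intrC a))) 'X] =
  pideal (pt C phi) by exact: pidealP.
have C1 : 1 != 0 :> C.
  apply/eqP => /(congr1 phi); rewrite rmorph1 rmorph0 => /eqP.
  by rewrite oner_eq0.
have [C' eC] := nontrivial_comNzRing C1; subst C.
have intrc (c : C') : commr_rmorph (intmul 1 : {rmorphism int -> C'}) c.
  by move=> m; exact: commr_int.
apply/funext => c; rewrite /preimage /=.
have -> : horner_morph (intrC (phi c)) = phi \o horner_morph (intrc c)
    :> {rmorphism {poly int} -> A}.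
  apply: rmorph_eq => p /=; rewrite /horner_morph -horner_map -map_poly_comp.
  by congr horner; apply: eq_map_poly => m /=; rewrite rmorph_int.
by rewrite ptM /preimage /= horner_morphX.
Qed.

(** * The empty scheme *)

Section ZeroMorphism.
Variables (A B : pzRingType).

Definition zero_morphism of all_equal_to (0 : B) := fun _ : A => 0 : B.

Variable B0 : all_equal_to (0 : B).

Let zero_morphism_nmod : GRing.nmod_morphism (zero_morphism B0).
Proof. by split=> [//|s t]; rewrite /zero_morphism addr0. Qed.

Let zero_morphism_monoid : GRing.monoid_morphism (zero_morphism B0).
Proof. by split=> [|s t]; rewrite [RHS]B0. Qed.

HB.instance Definition _ :=
  GRing.isNmodMorphism.Build _ _ (zero_morphism B0) zero_morphism_nmod.
HB.instance Definition _ :=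
  GRing.isMonoidMorphism.Build _ _ (zero_morphism B0) zero_morphism_monoid.

End ZeroMorphism.

(** The empty family covers the empty set, so the uniqueness of gluing already
    identifies all sections. *)
Lemma sections_empty (X : ringed_space) (U : opens X) (s t : rs_sheaf X U) :
  (U : set X) = set0 -> s = t.
Proof.
move=> U0.
have := @rs_sheafP X U False (fun=> U) (fun F => match F with end)
  (fun F => match F with end).
case=> [|[]|r [_ ru]]; first by rewrite U0 bigcup0.
by rewrite -(ru s) ?(ru t) // => -[].
Qed.

Lemma empty_initial (X : scheme) : is_empty X -> initial (X : Scheme).
Proof.
move=> X0 Y.
have noX (x : X) : False by have : [set: X] x by []; rewrite X0.
have s0 (U : opens X) : all_equal_to (0 : rs_sheaf X U).
  by move=> s; apply: sections_empty; apply/seteqP; split=> x // /noX.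
pose f (x : X) : scheme_lrs Y := match noX x with end.
have fc : continuous f by move=> x; have := noX x.
pose fs (V : opens (scheme_lrs Y)) :
  {rmorphism rs_sheaf Y V -> rs_sheaf X (preim_opens fc V)} :=
  zero_morphism (s0 (preim_opens fc V)).
have fn (V W : opens (scheme_lrs Y)) (h : W `<=` V)
    (h' : preim_opens fc W `<=` preim_opens fc V) (s : rs_sheaf Y V) :
  fs W (res _ h s) = res _ h' (fs V s) by rewrite [RHS]s0.
pose f0 : rs_hom X (scheme_lrs Y) := RsHom fn.
have fl (x : X) : local_hom (@stalk_map X (scheme_lrs Y) f0 x) by have := noX x.
exists (@LrsHom X (scheme_lrs Y) f0 fl) => g.
apply: lrs_hom_eq => [x|V s h]; first by have := noX x.
by rewrite s0 [RHS]s0.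
Qed.

(** * Trivialization on matrix rings *)

Theorem corollary6p4 (R : realType) (n : nat) (n_ge3 : (3 <= n)%N)
    (G : functor (opcat Ring) Scheme)
    (GSpec : nat_isomorphic (compF G (opF cRing_incl)) Spec) :
  is_empty (G 'M[R[i]]_n) /\ initial (G 'M[R[i]]_n).
Proof.
suff G0 : is_empty (G 'M[R[i]]_n) by split=> //; exact: empty_initial.
(* In size [n.+1] the matrix ring is visibly nontrivial. *)
case: n n_ge3 => // n n3.
apply/seteqP; split=> x // _.
have [P hP] := @point_prime_partial_ideal G GSpec 'M[R[i]]_n.+1 x.
exact: no_prime_partial_ideal hP n3.
Qed.
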